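(* Let $p$ be a prime and let $H_d$ be the free pro-$p$ group of rank $d\geq 1$, with normalised Haar measure $\mu$. Then there exists a subset $X\subset H_d$ with $X^{-1}=X$, $\mu(X)=0$ and $0<\mu(X^{\ast m})<1$ for some natural number $m$.
   Context: For a subset $X$ of a group and a positive integer $m$, $X^{\ast m}=\{x_1\cdots x_m\mid x_i\in X\text{ for all }i=1,\dots,m\}$. Haar measure is normalised so that $\mu(H_d)=1$. *)

(* Defs.v *)
From HB Require Import structures.
From mathcomp Require Import all_boot all_order all_algebra.
From mathcomp Require Import all_classical all_reals all_analysis.

Set Implicit Arguments.
Unset Strict Implicit.
Unset Printing Implicit Defensive.

Local Open Scope classical_set_scope.
Local Open Scope group_scope.

HB.mixin Record isTopologicalGroup G of Topological G & Group G := {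
  mulg_continuous : continuous (fun x : G * G => x.1 * x.2) ;
  invg_continuous : continuous (fun x : G => x^-1)
}.

#[short(type="topologicalGroupType")]
HB.structure Definition TopologicalGroup :=
  {G of Topological G & Group G & isTopologicalGroup G}.

Section SetOperations.
Context {G : groupType}.
Implicit Types (N X : set G) (g : G).

Definition translate g X : set G := [set g * x | x in X].

Definition set_inv X : set G := [set x^-1 | x in X].

Definition set_power X (m : nat) : set G :=
  [set y | exists2 x : 'I_m -> G, (forall i, X (x i)) & y = \prod_(i < m) x i].

Definition normal_subgroup N : Prop :=
  [/\ N 1,
      forall x y, N x -> N y -> N (x * y),
      forall x, N x -> N x^-1
    & forall x g, N x -> N (x ^ g)].

Definition left_cosets N : set (set G) := [set translate g N | g in [set: G]].

End SetOperations.

Definition profinite (G : topologicalGroupType) : Prop :=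
  [/\ compact [set: G], hausdorff_space G & totally_disconnected [set: G]].

Definition pro_p (p : nat) (G : topologicalGroupType) : Prop :=
  profinite G /\
  forall N : set G, normal_subgroup N -> open N ->
    exists k : nat, (left_cosets N #= `I_(p ^ k)%N)%card.

Definition continuous_hom (G K : topologicalGroupType) (f : G -> K) : Prop :=
  continuous f /\ {morph f : x y / x * y}.

(* The basis is finite, so the usual requirement that the given map to G
   converge to 1 along the basis is vacuous. *)
Definition free_pro_p_on (p d : nat) (H : topologicalGroupType)
    (x : 'I_d -> H) : Prop :=
  pro_p p H /\
  forall G : topologicalGroupType, pro_p p G ->
  forall f : 'I_d -> G,
  exists! phi : H -> G, continuous_hom phi /\ forall i, phi (x i) = f i.

Definition free_pro_p (p d : nat) (H : topologicalGroupType) : Prop :=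
  exists x : 'I_d -> H, free_pro_p_on p x.

(* Measurable types are pointed in the library; the point chosen here is 1. *)
Definition group_pointed (G : topologicalGroupType) : Type := G.

HB.instance Definition _ (G : topologicalGroupType) :=
  Choice.copy (group_pointed G) G.
HB.instance Definition _ (G : topologicalGroupType) :=
  isPointed.Build (group_pointed G) (1 : G).

Definition borelType (G : topologicalGroupType) :=
  g_sigma_algebraType (@open G : set (set (group_pointed G))).

Definition borel (G : topologicalGroupType) (A : set G) : Prop :=
  measurable (A : set (borelType G)).

(* The normalisation mu G = 1 is part of the type of mu; finiteness on compact
   sets then holds automatically. *)
Record normalised_haar (R : realType) (G : topologicalGroupType)
    (mu : probability (borelType G) R) : Prop := {
  haar_left_invariant : forall (g : G) (A : set G), borel A ->
    mu (translate g A) = mu A ;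
  haar_outer_regular : forall A : set G, borel A ->
    mu A = ereal_inf [set mu U | U in [set U : set G | open U /\ A `<=` U]] ;
  haar_inner_regular : forall U : set G, open U ->
    mu U = ereal_sup [set mu K | K in [set K : set G | compact K /\ K `<=` U]]
}.

(* Main.v *)
(* If [N] is a proper open normal subgroup and [N = A B^-1] with [A], [B] closed
   and null, then [X = A u B u A^-1 u B^-1] has [X X = N], and [N] has measure
   [1 / [H : N]]. Such [A] and [B] are intersections of decreasing clopen sets
   [A_n], [B_n] with [N = A_n B_n^-1]: if both are unions of cosets of a small
   normal subgroup, one may replace every such coset in [A_n] by a coset of a
   much smaller subgroup without spoiling the product, and then likewise for
   [B_n]; compactness carries the factorisation to the limit. The free pro-p
   group has arbitrarily small open normal subgroups because it maps onto every
   [Z / p^k]. *)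
Require Import Defs.
From HB Require Import structures.
From mathcomp Require Import all_boot all_order all_algebra all_fingroup.
From mathcomp Require Import cyclic.
From mathcomp Require Import all_classical all_reals all_analysis.

Set Implicit Arguments.
Unset Strict Implicit.
Unset Printing Implicit Defensive.

Import Order.TTheory GRing.Theory Num.Theory.

Local Open Scope classical_set_scope.
Local Open Scope group_scope.

(** * Finite unions of cosets in an abstract group *)

(** Left cosets listed by representatives. Repetitions are allowed, so [size F] only bounds the
    number of distinct cosets. *)
Definition cosets (G : groupType) (F : seq G) (N : set G) : set G :=
  [set x | exists2 f, f \in F & N (f^-1 * x)].

Lemma translateE (G : groupType) (g : G) (A : set G) :
  translate g A = (fun x => g^-1 * x) @^-1` A.
Proof.
apply/seteqP; split=> [_ [x Ax <-]|x Ax] /=; first by rewrite mulKg.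
by exists (g^-1 * x) => //; rewrite mulVKg.
Qed.

Lemma set_invE (G : groupType) (A : set G) : set_inv A = invg @^-1` A.
Proof.
apply/seteqP; split=> [_ [x Ax <-]|x Ax] /=; first by rewrite invgK.
by exists x^-1 => //; rewrite invgK.
Qed.

Lemma cosets_nil (G : groupType) (N : set G) : cosets [::] N = set0.
Proof. by apply/seteqP; split=> x // []. Qed.

Lemma cosets_cons (G : groupType) (f : G) (F : seq G) (N : set G) :
  cosets (f :: F) N = translate f N `|` cosets F N.
Proof.
apply/seteqP; rewrite translateE; split=> x /=.
  by case=> h; rewrite inE => /predU1P[->|hF] Nx; [left | right; exists h].
case=> [Nx|[h hF Nx]]; first by exists f; rewrite ?mem_head.
by exists h; rewrite // inE hF orbT.
Qed.

(** The inverse of [fN] is the right coset of [f^-1], which is also its left coset because [N] is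
    normal. *)
Lemma cosets_inv (G : groupType) (F : seq G) (N : set G) :
  normal_subgroup N -> set_inv (cosets F N) = cosets (map invg F) N.
Proof.
case=> _ _ NV NJ; rewrite set_invE; apply/seteqP; split=> x /= [f fF Nx].
  exists f^-1; first exact: map_f.
  by rewrite invgK; move/NV/(NJ _ f^-1): Nx; rewrite conjgE !invMg !invgK mulgK.
case/mapP: fF Nx => h hF -> Nx; exists h => //.
by move/NV/(NJ _ h): Nx; rewrite conjgE !invMg !invgK mulgVK.
Qed.

Lemma normal_subgroupI (G : groupType) (N N' : set G) :
  normal_subgroup N -> normal_subgroup N' -> normal_subgroup (N `&` N').
Proof.
case=> ? NM NV NJ [? NM' NV' NJ']; split=> //.
- by move=> x y [? ?] [? ?]; split; [exact: NM | exact: NM'].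
- by move=> x [? ?]; split; [exact: NV | exact: NV'].
- by move=> x g [? ?]; split; [exact: NJ | exact: NJ'].
Qed.

(** * Clopen cosets and compactness *)

Section TopologicalGroupSets.
Context {G : topologicalGroupType}.
Implicit Types (A B N : set G) (F : seq G).

Lemma continuous_mulgl (g : G) : continuous (fun x : G => g * x).
Proof.
move=> x; apply: (@continuous_comp _ _ G (fun x : G => (g, x))
  (fun y => y.1 * y.2)).
  by apply: cvg_pair => //; exact: cvg_cst.
exact: mulg_continuous.
Qed.

Lemma clopen_translate (g : G) A : clopen A -> clopen (translate g A).
Proof.
rewrite translateE => cA; apply: preimage_clopen => //.
exact: continuous_mulgl.
Qed.

Lemma clopen_cosets F N : clopen N -> clopen (cosets F N).
Proof.
move=> cN; elim: F => [|f F IH]; first by rewrite cosets_nil; exact: clopen0.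
by rewrite cosets_cons; apply: clopenU IH; exact: clopen_translate.
Qed.

Lemma closed_set_inv A : closed A -> closed (set_inv A).
Proof.
rewrite set_invE => cA; apply: preimage_closed => // x _.
exact: invg_continuous.
Qed.

Lemma open_borel A : open A -> borel A.
Proof. exact: sub_sigma_algebra. Qed.

Lemma closed_borel A : closed A -> borel A.
Proof.
move=> cA; rewrite /borel -[A]setCK; apply: measurableC.
apply: open_borel; exact: closed_openC.
Qed.

Lemma compact_cosets A N : compact [set: G] -> closed A -> open N -> N 1 ->
  exists F, (forall f, f \in F -> A f) /\ A `<=` cosets F N.
Proof.
move=> cG cA oN N1.
(* The covering form of compactness is used on a pointed space; the point chosen is 1. The cover
   consists of the translates of [N] by the points of [A]. *)
pose P : ptopologicalType := HB.pack G (isPointed.Build G 1).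
have cAP : compact (A : set P) by apply: subclosed_compact cA cG _.
rewrite compact_cover in cAP.
have [//||F FA AF] := cAP P (A : set P) (fun f => translate f N).
- move=> f _; rewrite translateE; apply: open_comp => // x _.
  exact: continuous_mulgl.
- by move=> x Ax; exists x => //; rewrite translateE /= mulVg.
exists (finmap.enum_fset F); split=> [f /FA|x /AF[f Ff]]; first by rewrite inE.
by rewrite translateE => Nx; exists f.
Qed.

(** A cluster point of a sequence [c n] in [C n] works: from index [n] on the sequence stays in the
    closed set [C n]. *)
Lemma compact_nested (C : nat -> set G) : compact [set: G] ->
  (forall n, closed (C n)) -> (forall n, C n.+1 `<=` C n) ->
  (forall n, C n !=set0) -> \bigcap_n C n !=set0.
Proof.
move=> cG cC dC /choice[c Cc].
have sC m n : (m <= n)%N -> C n `<=` C m.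
  elim: n => [|n IH]; first by rewrite leqn0 => /eqP ->.
  by rewrite leq_eqVlt => /predU1P[->//|/IH]; apply: subset_trans.
have [|x [_ cx]] := cG (c @ \oo) _; first exact: filterT.
exists x => n _; apply: cC => V /cx; apply.
by exists n => // m /= /sC; apply.
Qed.

End TopologicalGroupSets.

(** * Factoring an open normal subgroup through null sets *)

Section FactoringNullSets.
Context {R : realType} {G : topologicalGroupType}.
Variable mu : probability (borelType G) R.
Hypothesis mu_haar : normalised_haar mu.
Implicit Types (A B N : set G) (F : seq G) (n : nat).

Lemma haar_cosets F N : clopen N ->
  (mu (cosets F N) <= (size F)%:R%:E * mu N)%E.
Proof.
move=> cN; elim: F => [|f F IH]; first by rewrite cosets_nil measure0 mul0e.
have bN : borel N by apply: open_borel; case: cN.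
have bF : borel (cosets F N) by apply: open_borel; case: (clopen_cosets F cN).
have bf : borel (translate f N).
  by apply: open_borel; case: (clopen_translate f cN).
have mU : (mu (translate f N `|` cosets F N)
    <= mu (translate f N) + mu (cosets F N))%E := measureU2 mu bf bF.
rewrite cosets_cons; apply: le_trans mU _.
rewrite (haar_left_invariant mu_haar) //= -addn1 addnC natrD EFinD.
by rewrite ge0_muleDl ?lee_fin ?ler01 ?ler0n // mul1e; apply: leeD.
Qed.

(** A witness that [n * mu A <= 1]. A cover by cosets of a normal subgroup passes to arbitrary
    subsets, and to inverses using left invariance alone. *)
Definition thin n A : Prop := exists F N,
  [/\ normal_subgroup N, clopen N, A `<=` cosets F N
    & ((n * size F)%:R%:E * mu N <= 1)%E].

Lemma thin_inv n A : thin n A -> thin n (set_inv A).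
Proof.
case=> F [N [nN cN AF le1]]; exists (map invg F), N.
split; rewrite ?size_map //.
by rewrite -cosets_inv // => _ [x /AF Fx <-]; exists x.
Qed.

Lemma thin_sub n A B : A `<=` B -> thin n B -> thin n A.
Proof.
move=> AB [F [N [nN cN BF le1]]]; exists F, N; split=> //.
exact: subset_trans BF.
Qed.

Lemma thin_null A : borel A -> (forall n, thin n A) -> mu A = 0%E.
Proof.
move=> bA tA; have finA : mu A \is a fin_num by exact: fin_num_measure.
have nA n : (n%:R * fine (mu A) <= 1)%R.
  have [F [N [nN cN AF le1]]] := tA n.
  rewrite -lee_fin EFinM fineK //; apply: le_trans le1.
  rewrite natrM EFinM -muleA lee_wpmul2l ?lee_fin ?ler0n //.
  have bF := open_borel (proj1 (clopen_cosets F cN)).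
  by apply: le_trans (haar_cosets F cN); apply: le_measure; rewrite ?inE.
have [a0|] := ltP 0%R (fine (mu A)); last first.
  move=> a0; apply/eqP; rewrite -(fineK finA) eqe eq_le a0 /=.
  exact: fine_ge0.
have a1 : (0 <= (fine (mu A))^-1)%R by rewrite invr_ge0 ltW.
have := archi_boundP a1; rewrite -{1}div1r ltr_pdivrMr // => lt1.
by have := nA (Num.bound (fine (mu A))^-1); rewrite leNgt lt1.
Qed.

(** For a subgroup [N], this says that [A] is a union of left cosets of [N]. *)
Definition right_invariant N A := forall a x, A a -> N x -> A (a * x).

(* [N0] lies in the product of [A] and [set_inv B]; putting the inverse on [B]
   makes the condition symmetric in [A] and [B], since [N0] is a group. *)
Definition factoring N0 A B : Prop :=
  [/\ clopen A, clopen B, forall g, N0 g -> exists2 b, B b & A (g * b)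
    & exists N, [/\ normal_subgroup N, clopen N, right_invariant N A
                  & right_invariant N B]].

Lemma factoring_sym N0 A B :
  normal_subgroup N0 -> factoring N0 A B -> factoring N0 B A.
Proof.
case=> _ _ NV _ [cA cB AB [N [nN cN iA iB]]].
split=> //; last by exists N; split.
(* Applied to [g^-1], the hypothesis gives [b] in [B] with [g^-1 * b] in [A]; then
   [g * (g^-1 * b) = b]. *)
move=> g /NV/AB[b Bb Ab]; exists (g^-1 * b) => //.
by rewrite mulVKg.
Qed.

Hypothesis cG : compact [set: G].
Hypothesis small : forall n, exists N,
  [/\ normal_subgroup N, clopen N & (n%:R%:E * mu N <= 1)%E].

(* Keep one point of each coset of [N] in [A] and thicken these points by a
   subgroup [M] so small that their number no longer matters. The product with
   [B] survives because [B] absorbs [N]. *)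
Lemma factoring_thin n N0 A B : factoring N0 A B ->
  exists2 A', thin n A' /\ A' `<=` A & factoring N0 A' B.
Proof.
case=> cA cB AB [N [nN cN iA iB]]; have [N1 NM NV NJ] := nN.
have [F [FA AF]] := compact_cosets cG (proj2 cA) (proj1 cN) N1.
(* [M] is chosen after [F]: shrinking [N] to its intersection with [M] keeps the same
   representatives. *)
have [M [nM cM le1]] := small (n * size F).
have nNM := normal_subgroupI nN nM; have cNM := clopenI cN cM.
exists (cosets F (N `&` M)); first split.
- exists F, (N `&` M); split=> //; apply: le_trans le1.
  rewrite lee_wpmul2l ?lee_fin ?ler0n //.
  by apply: le_measure; rewrite ?inE; [exact: open_borel (proj1 cNM)
    | exact: open_borel (proj1 cM) | exact: subIsetr].
- by move=> x [f /FA Af [Nx _]]; rewrite -(mulVKg f x); exact: iA.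
split=> //; first exact: clopen_cosets.
(* Moving [b] inside its coset of [N] turns [g * b] into the representative [f] itself, which
   survives the thinning. *)
- move=> g /AB[b Bb /AF[f fF Nx]]; exists (b * (f^-1 * (g * b))^-1).
    by apply: iB => //; exact: NV.
  exists f => //; rewrite !invMg invgK !mulgA !mulgK mulVg.
  by case: nNM.
- exists (N `&` M); split=> //.
    move=> a x [f fF fa] Nx; exists f => //; rewrite mulgA.
    by case: nNM => _ + _ _; apply.
  by move=> a x Ba [Nx _]; exact: iB.
Qed.

Lemma factoring_step n N0 A B : normal_subgroup N0 -> factoring N0 A B ->
  exists A' B', [/\ A' `<=` A, B' `<=` B, thin n A', thin n B'
    & factoring N0 A' B'].
Proof.
move=> nN0 /(factoring_thin n)[A' [tA AA]] /(factoring_sym nN0).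
case/(factoring_thin n) => B' [tB BB] /(factoring_sym nN0) AB.
by exists A', B'.
Qed.

(** Iterate [factoring_step] from the pair [(N0, N0)] and intersect the resulting decreasing
    sets. *)
Lemma null_factoring N0 : normal_subgroup N0 -> clopen N0 ->
  exists A B, [/\ closed A, closed B, A `<=` N0 /\ B `<=` N0,
    forall n, thin n A /\ thin n B
    & forall g, N0 g -> exists2 b, B b & A (g * b)].
Proof.
move=> nN0 cN0.
(* The state carries its index, so that step [n] can ask for [n]-thin sets. *)
pose T := {s : nat * (set G * set G) | factoring N0 s.2.1 s.2.2}.
pose next (s t : T) := [/\ (sval t).1 = (sval s).1.+1,
  (sval t).2.1 `<=` (sval s).2.1, (sval t).2.2 `<=` (sval s).2.2,
  thin (sval s).1 (sval t).2.1 & thin (sval s).1 (sval t).2.2].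
have stepT s : {t | next s t}.
  apply: cid; case: s => -[n [A B]] /= AB.
  have [A' [B' [AA BB tA tB AB']]] := factoring_step n nN0 AB.
  by exists (exist _ (n.+1, (A', B')) AB').
have AB0 : factoring N0 (0%N, (N0, N0)).2.1 (0%N, (N0, N0)).2.2.
  have [N1 NM _ _] := nN0; split=> //.
    by move=> g gN0; exists 1 => //; rewrite mulg1.
  by exists N0.
have [s [s0 sS]] := dependent_choice stepT (exist _ (0%N, (N0, N0)) AB0).
have sn n : (sval (s n)).1 = n.
  by elim: n => [|n IH]; [rewrite s0 | case: (sS n) => ->; rewrite IH].
pose A n := (sval (s n)).2.1; pose B n := (sval (s n)).2.2.
have AB n : factoring N0 (A n) (B n) := svalP (s n).
have A0 : A 0%N = N0 by rewrite /A s0.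
have B0 : B 0%N = N0 by rewrite /B s0.
exists (\bigcap_n A n), (\bigcap_n B n); split.
- by apply: closed_bigI => n _; case: (AB n) => -[].
- by apply: closed_bigI => n _; case: (AB n) => _ -[].
- by rewrite -{1}A0 -B0; split=> x; apply.
- move=> n; have [_ _ _ tA tB] := sS n; rewrite !sn in tA tB.
  by split; [apply: thin_sub tA | apply: thin_sub tB] => x; apply.
move=> g gN0.
(* [C n] holds the possible values of [b] at stage [n]; a point common to all stages serves for the
   intersections. *)
pose C n := B n `&` (fun x => g * x) @^-1` A n.
have [|||x Cx] := @compact_nested G C cG.
- move=> n; have [[_ cA] [_ cB] _ _] := AB n; apply: closedI => //.
  by apply: preimage_closed => // x _; exact: continuous_mulgl.
- move=> n x [/= Bx Ax]; have [_ AA BB _ _] := sS n.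
  by split; [exact: BB | exact: AA].
- by move=> n; have [_ _ /(_ g gN0)[b Bb Ab] _] := AB n; exists b.
by exists x => n _; have [] := Cx n I.
Qed.

Lemma null_symmetric_root N0 : normal_subgroup N0 -> clopen N0 ->
  exists X, [/\ borel X, set_inv X = X, mu X = 0%E & set_power X 2 = N0].
Proof.
move=> nN0 cN0; have [_ NM NV _] := nN0.
have [A [B [cA cB [AN BN] tAB AB]]] := null_factoring nN0 cN0.
have nullS S : closed S -> (forall n, thin n S) -> mu S = 0%E.
  by move=> cS; apply: thin_null; exact: closed_borel.
have nullU S T : closed S -> closed T -> mu S = 0%E -> mu T = 0%E ->
    mu (S `|` T) = 0%E.
  move=> cS cT S0 T0; apply/eqP; rewrite eq_le measure_ge0 andbT.
  have mU : (mu (S `|` T) <= mu S + mu T)%E :=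
    measureU2 mu (closed_borel cS) (closed_borel cT).
  by apply: le_trans mU _; rewrite S0 T0 adde0.
have invK S : set_inv (set_inv S) = S.
  by rewrite !set_invE; apply/seteqP; split=> x /=; rewrite invgK.
have invU S T : set_inv (S `|` T) = set_inv S `|` set_inv T.
  by rewrite !set_invE.
pose Y := A `|` B.
have cY : closed Y by exact: closedU.
have cY' := closed_set_inv cY.
exists (Y `|` set_inv Y); split.
- by apply: closed_borel; exact: closedU.
- by rewrite invU invK setUC.
- have Y0 : mu Y = 0%E.
    by apply: (nullU) => //; apply: nullS => // n; case: (tAB n).
  (* Nullity of the inverses comes from [thin_inv], since only left invariance of [mu] is given. *)
  apply: (nullU) => //; rewrite invU; apply: (nullU); try exact: closed_set_inv.
    by apply: nullS => [|n]; [exact: closed_set_inv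
      | apply: thin_inv; case: (tAB n)].
  by apply: nullS => [|n]; [exact: closed_set_inv
    | apply: thin_inv; case: (tAB n)].
have YN : Y `|` set_inv Y `<=` N0.
  have YN0 : Y `<=` N0 by rewrite subUset.
  by rewrite subUset; split=> // _ [x /YN0/NV Nx <-].
apply/seteqP; split=> [_ [x Xx ->]|g gN0].
  by rewrite big_ord_recl big_ord1; apply: NM; exact: YN.
have [b Bb Ab] := AB g gN0.
(* Here [g = (g * b) * b^-1], with first factor in [A] and second in the inverse of [B]. *)
exists (fun i : 'I_2 => if i == ord0 then g * b else b^-1).
  by move=> i; case: ifP => _; [left; left | right; exists b => //; right].
by rewrite big_ord_recl big_ord1 /= mulgK.
Qed.

End FactoringNullSets.

(** * Finite [p]-groups as discrete pro-[p] groups *)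

(** A separate name for [gT], to which the discrete topology is attached. *)
Definition discrete_group (gT : finGroupType) : Type := gT.

HB.instance Definition _ (gT : finGroupType) :=
  Group.copy (discrete_group gT) gT.
HB.instance Definition _ (gT : finGroupType) :=
  hasNbhs.Build (discrete_group gT) principal_filter.
HB.instance Definition _ (gT : finGroupType) :=
  Discrete_ofNbhs.Build (discrete_group gT) erefl.

Lemma discrete_mulg_continuous (gT : finGroupType) :
  continuous (fun x : discrete_group gT * discrete_group gT => x.1 * x.2).
Proof.
move=> [x y]; apply/discrete_cvg.
exists ([set x], [set y]) => [|[a b] [/= -> ->]//].
by split; exact: discrete_set1.
Qed.

Lemma discrete_invg_continuous (gT : finGroupType) :
  continuous (fun x : discrete_group gT => x^-1).
Proof.
move=> x; apply/discrete_cvg.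
have := discrete_set1 x.
by apply: (@filterS _ (nbhs x) (nbhs_filter x) [set x]) => _ ->.
Qed.

HB.instance Definition _ (gT : finGroupType) :=
  isTopologicalGroup.Build (discrete_group gT)
    (@discrete_mulg_continuous gT) (@discrete_invg_continuous gT).

(** By Lagrange the index of a subgroup divides [p ^ n], hence is a power of [p]; the rest matches
    set-theoretic cosets with those of the finite group. *)
Lemma discrete_group_pro_p (p n : nat) (gT : finGroupType) : prime p ->
  #|gT| = (p ^ n)%N -> pro_p p (discrete_group gT).
Proof.
move=> p_pr gTn; split.
  split.
  - apply: finite_compact; apply: (@finite_finset gT).
  - exact: discrete_hausdorff.
  - apply: zero_dimension_totally_disconnected; exact: discrete_zero_dimension.
move=> N [N1 NM NV NJ] oN.
pose S : {set gT} := [set x | `[< N x >]]%SET.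
have gS : group_set S.
  by apply/group_setP; split=> [|x y]; rewrite !inE; [exact: N1 | exact: NM].
pose K := Group gS; pose T := [set: gT]%G.
have [k _ Ek] : exists2 k, (k <= n)%N & #|T : K| = (p ^ k)%N.
  by apply/(dvdn_pfactor _ _ p_pr); rewrite -gTn -cardsT (dvdn_indexg T K).
exists k; rewrite -Ek -card_lcosets.
pose toset (A : {set gT}) : set (discrete_group gT) := [set x | x \in A].
have toset_inj : injective toset.
  by move=> A B AB; apply/setP => x; apply/idP/idP => Hx;
    [change (toset B x); rewrite -AB | change (toset A x); rewrite AB].
have tosetK g : toset (lcoset K g) = translate g N.
  rewrite translateE; apply/seteqP; split=> x.
    by rewrite /toset /= lcosetE mem_lcoset inE => /asboolP.
  by move=> Nx; rewrite /toset /= lcosetE mem_lcoset inE; apply/asboolP.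
have -> : left_cosets N =
    (fun i : 'I_#|lcosets K T| => toset (enum_val i)) @` setT.
  apply/seteqP; split=> [_ [g _ <-]|_ [i _ <-]].
    have Kg : lcoset K g \in lcosets K T by apply: imset_f; rewrite inE.
    exists (enum_rank_in Kg (lcoset K g)) => //.
    by rewrite enum_rankK_in ?tosetK.
  have /imsetP[g _ ->] := enum_valP i.
  by exists g => //; rewrite tosetK.
apply: card_eq_trans (card_esym card_II).
by apply: inj_card_eq => i j _ _ /toset_inj/enum_val_inj.
Qed.

(** * Kernels of homomorphisms to finite groups and their measure *)

Lemma continuous_hom1 (G K : topologicalGroupType) (f : G -> K) :
  continuous_hom f -> f 1 = 1.
Proof. by case=> _ fM; apply: (mulIg (f 1)); rewrite -fM !mul1g. Qed.

Lemma continuous_homV (G K : topologicalGroupType) (f : G -> K) :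
  continuous_hom f -> {morph f : x / x^-1}.
Proof.
move=> hf x; apply: (mulIg (f x)).
by case: (hf) => _ fM; rewrite -fM !mulVg continuous_hom1.
Qed.

Definition hom_kernel (G K : groupType) (f : G -> K) : set G := f @^-1` [set 1].

Lemma clopen_normal_kernel (G : topologicalGroupType) (gT : finGroupType)
    (f : G -> discrete_group gT) : continuous_hom f ->
  normal_subgroup (hom_kernel f) /\ clopen (hom_kernel f).
Proof.
move=> hf; have f1 := continuous_hom1 hf; have fV := continuous_homV hf.
have [cf fM] := hf; rewrite /hom_kernel; split.
  split=> //= [x y fx fy|x fx|x g fx].
  - by rewrite fM fx fy mulg1.
  - by rewrite fV fx invg1.
  - by rewrite conjgE !fM fV fx mul1g mulVg.
apply: preimage_clopen cf.
by split; [exact: discrete_open | exact: discrete_closed].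
Qed.

(** The translates are disjoint and all have measure [mu N], while the whole group has measure 1. *)
Lemma measure_disjoint_translates (R : realType) (G : topologicalGroupType)
    (mu : probability (borelType G) R) (n : nat) (N : set G) (x : 'I_n -> G) :
  normalised_haar mu -> clopen N ->
  (forall i j, (translate (x i) N `&` translate (x j) N) !=set0 -> i = j) ->
  (n%:R%:E * mu N <= 1)%E.
Proof.
move=> mu_haar cN dis.
have bN i : borel (translate (x i) N).
  exact: open_borel (proj1 (clopen_translate (x i) cN)).
have tN : trivIset setT (fun i => translate (x i) N).
  by move=> i j _ _; exact: dis.
have bU : borel (\big[setU/set0]_(i < n) translate (x i) N).
  by apply: (@bigsetU_measurable _ (borelType G)) => i _; exact: bN.
have E : mu (\big[setU/set0]_(i < n) translate (x i) N)
    = (\sum_(i < n) mu (translate (x i) N))%E.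
  exact: (measure_bigsetU_ord mu predT bN tN).
have fN : mu N \is a fin_num by exact: fin_num_measure (open_borel (proj1 cN)).
apply: le_trans (probability_le1 mu bU).
rewrite E (eq_bigr (fun=> (fine (mu N))%:E)); last first.
  move=> i _; rewrite (haar_left_invariant mu_haar) ?fineK //.
  exact: open_borel (proj1 cN).
by rewrite sumEFin sumr_const card_ord -[(fine _ *+ n)%R]mulr_natl EFinM fineK.
Qed.

(** The translates of the kernel by [x ^+ i], for [i] below the order of [f x], are disjoint: [f] is
    constantly [f x ^+ i] on each. *)
Lemma kernel_measure (R : realType) (G : topologicalGroupType)
    (mu : probability (borelType G) R) (gT : finGroupType)
    (f : G -> discrete_group gT) (x : G) :
  normalised_haar mu -> continuous_hom f ->
  (#[f x : gT]%:R%:E * mu (hom_kernel f) <= 1)%E.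
Proof.
move=> mu_haar hf; have [nK cK] := clopen_normal_kernel hf; have [_ fM] := hf.
have fX n : f (x ^+ n) = f x ^+ n.
  elim: n => [|n IH]; first by rewrite !expg0 continuous_hom1.
  by rewrite !expgS fM IH.
apply: (measure_disjoint_translates (x := fun i => x ^+ i) mu_haar cK) => i j.
case=> y []; rewrite !translateE /hom_kernel /= !fM !(continuous_homV hf) !fX.
move=> /(congr1 (fun z => f x ^+ i * z)); rewrite mulVKg mulg1 => ->.
move=> /(congr1 (fun z => f x ^+ j * z)); rewrite mulVKg mulg1 => eij.
(* The equality is restated in the finite group, where exponents are compared modulo the order. *)
have /eqP : (f x : gT) ^+ i = (f x : gT) ^+ j by exact: eij.
by rewrite eq_expg_mod_order !modn_small // => /eqP/val_inj.
Qed.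

(** * Small open normal subgroups of the free pro-[p] group, and the conclusion *)

(** Sending every basis element to a generator of the cyclic group of order [p ^ k] gives a
    homomorphism whose kernel is as small as required; [0 < d] supplies a basis element. *)
Lemma free_pro_p_kernel (p d k : nat) (R : realType) (H : topologicalGroupType)
    (mu : probability (borelType H) R) : prime p -> (0 < d)%N -> (0 < k)%N ->
  free_pro_p p d H -> normalised_haar mu ->
  exists N, [/\ normal_subgroup N, clopen N & ((p ^ k)%:R%:E * mu N <= 1)%E].
Proof.
move=> p_pr d0 k0 [x [_ x_free]] mu_haar.
(* The type ['Z_m] has [m] elements only for [m > 1], whence [0 < k]. *)
have pk1 : (1 < p ^ k)%N by rewrite -(exp1n k) ltn_exp2r // prime_gt1.
pose gT : finGroupType := 'Z_(p ^ k); pose a : gT := Zp1.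
have gTn : #|gT| = (p ^ k)%N by rewrite card_ord Zp_cast.
have [phi [[hphi phix] _]] :=
  x_free _ (discrete_group_pro_p p_pr gTn) (fun=> a).
have [nK cK] := clopen_normal_kernel hphi.
exists (hom_kernel phi); split=> //.
have := kernel_measure (x (Ordinal d0)) mu_haar hphi.
by rewrite phix order_Zp1 Zp_cast.
Qed.

Theorem corollary3p4 (p d : nat) (p_prime : prime p) (d_ge1 : (1 <= d)%N)
    (H : topologicalGroupType) (H_free : free_pro_p p d H)
    (R : realType) (mu : probability (borelType H) R)
    (mu_haar : normalised_haar mu) :
  exists X : set H,
    [/\ borel X, set_inv X = X, mu X = 0%E
      & exists m : nat, [/\ (0 < m)%N, borel (set_power X m),
          (0 < mu (set_power X m))%E & (mu (set_power X m) < 1)%E]].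
Proof.
have cH : compact [set: H] by case: H_free => x [[[]]].
have p1 := prime_gt1 p_prime.
have small n : exists N : set H,
    [/\ normal_subgroup N, clopen N & (n%:R%:E * mu N <= 1)%E].
  (* The exponent [n.+1] is positive and satisfies [n <= p ^ n.+1]. *)
  have [N [nN cN le1]] :=
    free_pro_p_kernel p_prime d_ge1 (ltn0Sn n) H_free mu_haar.
  exists N; split=> //; apply: le_trans le1.
  rewrite lee_wpmul2r // lee_fin ler_nat.
  by apply: leq_trans (ltnW (ltn_expl n p1)) _; rewrite leq_exp2l.
(* Exponent 1 gives [p * mu N <= 1], which keeps [mu N] below 1. *)
have [N [nN cN le1]] :=
  free_pro_p_kernel p_prime d_ge1 (ltn0Sn 0) H_free mu_haar.
have bN := open_borel (proj1 cN).
have [X [bX XV X0 XX]] := null_symmetric_root mu_haar cH small nN cN.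
exists X; split=> //; exists 2%N; rewrite XX; split=> //.
(* Finitely many cosets of [N] cover [H], so [mu N = 0] would force [mu H = 0]. *)
- rewrite lt_neqAle measure_ge0 andbT eq_sym; apply/eqP => N0.
  have [N1 _ _ _] := nN.
  have [F [_ TF]] := compact_cosets cH closedT (proj1 cN) N1.
  have := haar_cosets mu_haar F cN; rewrite N0 mule0.
  have -> : cosets F N = setT by apply/seteqP; split.
  by rewrite probability_setT leNgt lte01.
- rewrite ltNge; apply/negP => N1; move: le1; rewrite leNgt => /negP; apply.
  rewrite expn1; apply: (@lt_le_trans _ _ (p%:R%:E)%E).
    by rewrite lte_fin ltr1n.
  by rewrite -{1}[p%:R%:E]mule1 lee_wpmul2l // lee_fin ler0n.
Qed.
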